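(* Let $1<p\le q<\infty$ and $\alpha>-1$. Then the positive Bergman operator $$P_\alpha^+f(z)=\int_{\mathcal{H}}\frac{f(w)}{|z-\bar w|^{2+\alpha}}\,dV_\alpha(w),\qquad z\in\mathcal{H},$$ is bounded from $L^p(\mathcal{H},y^\alpha dx\,dy)$ into $L^q(\mathcal{H},y^{\alpha+(2+\alpha)(\frac{q}{p}-1)}dx\,dy)$.
   Context: $\mathcal{H}=\{z=x+iy\in\mathbb{C}: y>0\}$ is the upper half-plane and $dV_\alpha(x+iy)=y^\alpha\,dx\,dy$. $P_\alpha^+$ is obtained from the Bergman projection $P_\alpha$ by replacing its kernel $K^\alpha(z,w)=(z-\bar w)^{-(2+\alpha)}$ by $|K^\alpha(z,w)|$. *)

(* Defs.v *)
From HB Require Import structures.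
From mathcomp Require Import all_boot all_order all_algebra.
From mathcomp Require Import all_classical all_reals all_analysis.
From mathcomp Require Import measurable_realfun.
From mathcomp Require Import complex.

Set Implicit Arguments.
Unset Strict Implicit.
Unset Printing Implicit Defensive.
Import Order.TTheory GRing.Theory Num.Theory.
Import numFieldNormedType.Exports.
Import ComplexField.Normc.
Local Open Scope classical_set_scope.
Local Open Scope ring_scope.
Local Open Scope complex_scope.

(* The point x + iy is represented by the pair (x, y), so that measurability and
   planar Lebesgue measure are those of the product R * R. *)
Definition toC (R : realType) (z : R * R) : R[i] := z.1 +i* z.2.

Definition upper_half_plane (R : realType) : set (R * R) := [set z | 0 < z.2].
Arguments upper_half_plane R : clear implicits.

Lemma measurable_upper_half_plane (R : realType) :
  measurable (upper_half_plane R).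
Proof.
rewrite (_ : upper_half_plane R = setT `&` (snd @^-1` `]0, +oo[%classic)).
  by apply: measurable_snd => //; exact: measurable_itv.
by apply/seteqP; split=> z /=; rewrite in_itv /= andbT // => -[].
Qed.

(* y^beta dx dy on the upper half-plane; as a measure on the whole plane it does
   not charge {y <= 0}. *)
Section weighted_area.
Context (R : realType) (beta : R).

Definition weighted_area (A : set (R * R)) : \bar R :=
  (\int[(@lebesgue_measure R) \x (@lebesgue_measure R)]_(z in
     A `&` upper_half_plane R) (z.2 `^ beta)%:E)%E.

Let measurable_weight (D : set (R * R)) :
  measurable_fun D (fun z : R * R => (z.2 `^ beta)%:E).
Proof.
apply/measurable_EFinP; apply: measurable_funTS.
exact: (measurableT_comp (measurable_powR beta) measurable_snd).
Qed.

Let weighted_area0 : weighted_area set0 = 0%E.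
Proof. by rewrite /weighted_area set0I integral_set0. Qed.

Let weighted_area_ge0 A : (0 <= weighted_area A)%E.
Proof. by apply: integral_ge0 => z _; rewrite lee_fin powR_ge0. Qed.

Let weighted_area_sigma_additive : semi_sigma_additive weighted_area.
Proof.
move=> F mF tF mUF; rewrite /weighted_area setI_bigcupl.
rewrite ge0_integral_bigcup//=.
- apply: is_cvg_ereal_nneg_natsum_cond => n _ _.
  by apply: integral_ge0 => z _; rewrite lee_fin powR_ge0.
- move=> n; apply: measurableI; first exact: mF.
  exact: measurable_upper_half_plane.
- exact: measurable_weight.
- by move=> z _; rewrite lee_fin powR_ge0.
- exact: trivIset_setIr.
Qed.

HB.instance Definition _ := isMeasure.Build _ _ _ weighted_area
  weighted_area0 weighted_area_ge0 weighted_area_sigma_additive.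

End weighted_area.

Section complex_valued.
Context d (T : measurableType d) (R : realType).
Implicit Types (mu : {measure set T -> \bar R}) (D : set T) (f : T -> R[i]).

Definition cmeasurable_fun D f :=
  measurable_fun D (fun x => complex.Re (f x)) /\
  measurable_fun D (fun x => complex.Im (f x)).

Definition cintegrable mu D f :=
  mu.-integrable D (fun x => (complex.Re (f x))%:E) /\
  mu.-integrable D (fun x => (complex.Im (f x))%:E).

Definition cintegral mu D f : R[i] :=
  (\int[mu]_(x in D) complex.Re (f x)) +i* (\int[mu]_(x in D) complex.Im (f x)).

(* L^p(D, mu) for complex-valued functions, whose values outside D are junk. *)
Definition cLnorm mu D (p : \bar R) f : \bar R :=
  'N[mu]_p[(fun x => (normc (f x))%:E) \_ D].

Definition in_Lp mu D (p : \bar R) f :=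
  cmeasurable_fun D f /\ (cLnorm mu D p f < +oo)%E.

End complex_valued.

Section positive_bergman.
Context (R : realType) (alpha : R).

Definition positive_bergman_integrand (f : R * R -> R[i]) (z w : R * R) : R[i] :=
  f w / (normc (toC z - (toC w)^*) `^ (2 + alpha))%:C.

Definition positive_bergman (f : R * R -> R[i]) (z : R * R) : R[i] :=
  cintegral (weighted_area alpha) (upper_half_plane R)
    (positive_bergman_integrand f z).

(* P_alpha^+ is bounded from L^p(y^a dx dy) into L^q(y^b dx dy): for f in L^p
   the integral converges absolutely at each point of the half-plane, and
   P_alpha^+ f is in L^q with norm at most C ||f||_p. *)
Definition positive_bergman_bounded (a : R) (p : \bar R) (b : R) (q : \bar R) :=
  exists C : R, forall f : R * R -> R[i],
    in_Lp (weighted_area a) (upper_half_plane R) p f ->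
    [/\ forall z, upper_half_plane R z ->
          cintegrable (weighted_area alpha) (upper_half_plane R)
            (positive_bergman_integrand f z),
        in_Lp (weighted_area b) (upper_half_plane R) q (positive_bergman f) &
        (cLnorm (weighted_area b) (upper_half_plane R) q (positive_bergman f) <=
         C%:E * cLnorm (weighted_area a) (upper_half_plane R) p f)%E].

End positive_bergman.

(* Main.v *)
Require Import Defs.
From HB Require Import structures.
From mathcomp Require Import all_boot all_order all_algebra.
From mathcomp Require Import all_classical all_reals all_analysis.
From mathcomp Require Import measurable_realfun complex ring lra.

(** Write s = 2 + alpha, mu for the measure y^alpha dx dy and
    G(z) = int F(w) / |z - conj w|^s dmu(w) for a function F >= 0.

    Everything rests on one estimate. For a > -1 and b > a + 2,
      int_H v^a / |z - conj w|^b du dv <= C y^(a + 2 - b),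
    where z = x + iy and w = u + iv: both sides have the same homogeneity in z,
    and |z - conj w| >= (|x - u| + y + v) / 2 reduces the integral to power
    integrals, first in u and then in v ([integral_half_plane_kernel]).

    - For p = q this feeds Schur's test ([schur_test]) with the test function
      v^(-t), t = (alpha + 1) / (p p'), where p' is the conjugate exponent: the
      powers v^(-t p) and v^(-t p') are integrable near 0 against mu because
      t p and t p' are less than alpha + 1, and have finite integrals against the
      kernel at infinity because t > 0. Hence G is in L^p(mu) with
      the right bound ([positive_potential_Lp]).

    - The same estimate with b = s p' and Hoelder's inequality give
      G(z) <= A y^(-s/p) ||F||_p ([positive_potential_pointwise]).

    - For q > p, writing G^q = G^p G^(q - p) and bounding the second factor
      pointwise produces the power y^(-s (q - p) / p), which is exactly what the
      extra weight y^(s (q/p - 1)) absorbs, so the L^q norm is controlled by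
      the L^p norm of G ([positive_potential_Lp_Lq]).

    A complex-valued f is treated through F = |f|: the real and imaginary parts
    of the operator applied to f are dominated by G, which is finite at each
    point by the pointwise bound. *)

Set Implicit Arguments.
Unset Strict Implicit.
Unset Printing Implicit Defensive.
Import Order.TTheory GRing.Theory Num.Theory.
Import numFieldNormedType.Exports.
Import ComplexField.Normc.
Import HBNNSimple.
Local Open Scope classical_set_scope.
Local Open Scope ring_scope.

(** * Integrals of powers on the line *)

Lemma powR_cvgy0 (R : realType) (m : R) : 0 < m ->
  t `^ (- m) @[t --> +oo] --> (0 : R).
Proof.
move=> m0; apply/cvgrPdist_le => e e0.
near=> t.
have t0 : 0 < t by near: t; exact: nbhs_pinfty_gt.
rewrite sub0r normrN ger0_norm ?powR_ge0// powRN.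
rewrite invf_ple ?posrE ?powR_gt0//.
have -> : e^-1 = (e^-1 `^ m^-1) `^ m.
  by rewrite -powRrM mulVf ?gt_eqF// powRr1// invr_ge0 ltW.
apply: ge0_ler_powR; [exact: ltW|exact: powR_ge0|exact: ltW|].
by near: t; apply: nbhs_pinfty_ge; exact: num_real.
Unshelve. all: by end_near. Qed.

Lemma is_derive_powR_shift (R : realType) (d r x : R) : 0 < x + d -> r != 0 ->
  is_derive x 1 (fun t => (t + d) `^ r / r) ((x + d) `^ (r - 1)).
Proof.
move=> xd r0.
have -> : (fun t => (t + d) `^ r / r) =
    r^-1 \*: ((fun u => u `^ r) \o (fun t => t + d)).
  by apply/funext => t /=; rewrite mulrC.
have -> : (x + d) `^ (r - 1) = r^-1 *: (r * (x + d) `^ (r - 1) * (1 + 0)) :> R.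
  by rewrite addr0 mulr1 /GRing.scale/= mulrA mulVf// mul1r.
apply: is_deriveZ.
apply: (@is_derive1_comp _ (fun u => u `^ r)).
exact: is_derive1_powR.
Qed.

Lemma continuous_powR_shift (R : realType) (d r x : R) : 0 < x + d ->
  {for x, continuous (fun t : R => (t + d) `^ r)}.
Proof.
move=> xd; apply: differentiable_continuous; apply/derivable1_diffP.
apply: (@ex_derive _ _ _ _ _ _ (r * (x + d) `^ (r - 1) * (1 + 0))).
apply: (@is_derive1_comp _ (fun u => u `^ r)).
exact: is_derive1_powR.
Qed.

Lemma integral_powR_shifty (R : realType) (a d b : R) : 0 < a + d -> 1 < b ->
  (\int[lebesgue_measure]_(t in `[a, +oo[) ((t + d) `^ (- b))%:E =
   ((a + d) `^ (1 - b) / (b - 1))%:E)%E.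
Proof.
move=> ad b1.
have b0 : 1 - b != 0 by rewrite lt_eqF// subr_lt0.
have pos x : a <= x -> 0 < x + d.
  by move=> ax; apply: lt_le_trans ad _; rewrite lerD2r.
rewrite (@ge0_continuous_FTC2y _ _ (fun t => (t + d) `^ (1 - b) / (1 - b)) a 0).
- rewrite sub0e -EFinN; congr EFin.
  by rewrite -(opprB b 1) invrN mulrN opprK opprB.
- by move=> x _; exact: powR_ge0.
- apply: continuous_in_subspaceT => x; rewrite inE/= in_itv/= andbT => ax.
  exact/continuous_powR_shift/pos.
- rewrite -[X in _ --> X](mul0r (1 - b)^-1); apply: cvgMr_tmp.
  rewrite -(opprB b 1).
  apply: (@cvg_comp _ _ _ (fun t => t + d) (fun t => t `^ (- (b - 1))) _ +oo).
    exact: cvg_addrr.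
  by apply: powR_cvgy0; rewrite subr_gt0.
- by move=> x /ltW /pos xd; have [] := is_derive_powR_shift xd b0.
- apply: cvg_at_right_filter.
  apply: cvgMr_tmp; exact: (@continuous_powR_shift _ d (1 - b) a ad).
- move=> x; rewrite in_itv/= andbT => /ltW /pos xd.
  have [_] := is_derive_powR_shift xd b0.
  by rewrite derive1E => ->; congr (_ `^ _); lra.
Qed.

Lemma integral_powR_bndNy (R : realType) (a d b : R) : 0 < d - a -> 1 < b ->
  (\int[lebesgue_measure]_(t in `]-oo, a]) ((d - t) `^ (- b))%:E =
   ((d - a) `^ (1 - b) / (b - 1))%:E)%E.
Proof.
move=> ad b1; rewrite -{1}(opprK a) ge0_integration_by_substitutionNy.
- under eq_integral do rewrite /= opprK addrC.
  by rewrite integral_powR_shifty// addrC.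
- apply: continuous_in_subspaceT => x; rewrite inE/= in_itv/= opprK => ax.
  have -> : (fun t => (d - t) `^ (- b)) = (fun t => (t + d) `^ (- b)) \o -%R.
    by apply/funext => t /=; rewrite addrC.
  apply: (@continuous_comp _ _ _ -%R (fun t => (t + d) `^ (- b))).
    exact: opp_continuous.
  by apply: continuous_powR_shift; lra.
- by move=> x _; exact: powR_ge0.
Qed.

(** The integrand may be unbounded at 0, where the fundamental theorem of
    calculus does not apply; the interval is exhausted by the [y / n, y]. *)
Lemma integral_powR0 (R : realType) (a y : R) : -1 < a -> 0 < y ->
  (\int[lebesgue_measure]_(t in `]0%R, y]) (t `^ a)%:E =
   (y `^ (a + 1) / (a + 1))%:E)%E.
Proof.
move=> a1 y0.
have a0 : 0 < a + 1 by lra.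
have H (e : R) : 0 < e -> e < y ->
  (\int[lebesgue_measure]_(t in `[e, y]) (t `^ a)%:E =
    (y `^ (a + 1) / (a + 1))%:E - (e `^ (a + 1) / (a + 1))%:E)%E.
  move=> e0 ey.
  have D (x : R) : 0 < x ->
      is_derive x 1 (fun t : R => t `^ (a + 1) / (a + 1)) (x `^ a).
    move=> x0; have := @is_derive_powR_shift _ 0 (a + 1) x.
    rewrite addrK addr0 gt_eqF// => /(_ x0 isT); congr is_derive.
    by apply/funext => t; rewrite addr0.
  have C (x : R) : 0 < x ->
      {for x, continuous (fun t : R => t `^ (a + 1) / (a + 1))}.
    move=> /D [Dx _]; apply: differentiable_continuous; exact/derivable1_diffP.
  rewrite (@continuous_FTC2 _ _ (fun t : R => t `^ (a + 1) / (a + 1)))//.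
  - apply: continuous_in_subspaceT => x; rewrite inE/= in_itv/= => /andP[ex _].
    have -> : (fun t : R => t `^ a) = (fun t : R => (t + 0) `^ a).
      by apply/funext => t; rewrite addr0.
    by apply: continuous_powR_shift; rewrite addr0; exact: lt_le_trans ex.
  - split.
    + move=> x; rewrite in_itv/= => /andP[ex _].
      by have [] := D _ (lt_trans e0 ex).
    + by apply: cvg_at_right_filter; exact: C.
    + by apply: cvg_at_left_filter; exact: C.
  - move=> x; rewrite in_itv/= => /andP[ex _].
    by have [_] := D _ (lt_trans e0 ex); rewrite derive1E.
pose F (n : nat) : set R := `[y / n.+2%:R, y]%classic.
have FE : `]0, y]%classic = \bigcup_n F n.
  apply/seteqP; split=> [x|x [n _]]; rewrite /F /= !in_itv/= => /andP[x0 xy].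
  - have xy0 : 0 < y / x by rewrite divr_gt0.
    have := archi_boundP (ltW xy0); set n := Num.bound _ => yn.
    exists n => //=; rewrite in_itv/= xy andbT.
    rewrite ler_pdivrMr// mulrC -ler_pdivrMr//.
    by rewrite (le_trans (ltW yn))// ler_nat -addn2 leq_addr.
  - by rewrite xy andbT (lt_le_trans _ x0)// divr_gt0.
have /cvg_unique : (\int[lebesgue_measure]_(t in F i) (t `^ a)%:E @[i --> \oo]
    --> \int[lebesgue_measure]_(t in `]0%R, y]) (t `^ a)%:E)%E.
  rewrite FE; apply: ge0_nondecreasing_set_cvg_integral.
  - move=> m n mn; rewrite subsetEset /F => x /=.
    rewrite !in_itv/= => /andP[yx ->]; rewrite andbT (le_trans _ yx)//.
    by rewrite ler_pM2l// lef_pV2 ?posrE// ler_nat !ltnS.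
  - by move=> i; exact: measurable_itv.
  - by move=> i; apply/measurable_EFinP/measurable_funTS; exact: measurable_powR.
  - by move=> i x _; rewrite lee_fin powR_ge0.
apply => //.
have -> : (fun i => \int[lebesgue_measure]_(t in F i) (t `^ a)%:E)%E =
   EFin \o (fun n : nat => y `^ (a + 1) / (a + 1) -
     (y / n.+2%:R) `^ (a + 1) / (a + 1)).
  apply/funext => n; rewrite /F H//= ?divr_gt0//.
  by rewrite ltr_pdivrMr// ltr_pMr// ltr1n.
apply: cvg_EFin; first exact: nearW.
rewrite -[X in _ --> X]subr0; apply: cvgB; first exact: cvg_cst.
rewrite -(mul0r (a + 1)^-1); apply: cvgMr_tmp.
have yn : (y / n.+2%:R) @[n --> \oo] --> (0 : R).
  rewrite -[X in _ --> X](mulr0 y); apply: cvgMl_tmp.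
  apply/gtr0_cvgV0; first exact: nearW.
  rewrite (_ : (fun n => _) = (fun n => n%:R) \o (fun n => n + 2)%N); last first.
    by apply/funext => n; rewrite /= addn2.
  apply: cvg_comp; first exact: cvg_addnr.
  exact: cvgr_idn.
have [+ _] := @cvg_at_rightP _ (fun t : R => t `^ (a + 1)) 0 0.
move=> /(_ (powR_cvg0 a0)) /(_ (fun n => y / n.+2%:R)); apply; split => //.
by move=> n; rewrite divr_gt0.
Qed.

(** * Weighted areas of the half-plane *)

Section weighted_area_theory.
Context (R : realType) (beta : R).
Local Notation area := ((@lebesgue_measure R) \x (@lebesgue_measure R))%E.
Local Notation H := (upper_half_plane R).

Lemma measurable_weight (D : set (R * R)) :
  measurable_fun D (fun z : R * R => (z.2 `^ beta)%:E).
Proof.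
apply/measurable_EFinP; apply: measurable_funTS.
exact: (measurableT_comp (measurable_powR beta) measurable_snd).
Qed.

Lemma integral_weighted_area_nnsfun (g : {nnsfun (R * R)%type >-> R}) :
  (\int[weighted_area beta]_z (g z)%:E =
   \int[area]_(z in H) ((g z)%:E * (z.2 `^ beta)%:E))%E.
Proof.
have mH := @measurable_upper_half_plane R.
have mg r : measurable (g @^-1` [set r]) := measurable_funPTI g (measurable_set1 r).
rewrite integralT_nnsfun sintegralE.
under [RHS]eq_integral => z _.
  rewrite fimfunE -fsumEFin// ge0_mule_fsuml; last first.
    by move=> r; exact: nnfun_muleindic_ge0.
  over.
rewrite ge0_integral_fsum//=; last 2 first.
- move=> r; apply: emeasurable_funM; last exact: measurable_weight.
  apply/measurable_EFinP; apply: measurable_funM => //.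
  by apply: measurable_indic; apply: mg.
- move=> r z _; rewrite EFinM; apply: mule_ge0; rewrite ?lee_fin ?powR_ge0//.
  exact: nnfun_muleindic_ge0.
apply: eq_fsbigr => r; rewrite inE => -[z0 _ <-].
rewrite [in LHS]/weighted_area/=.
under [RHS]eq_integral do rewrite EFinM -muleA.
rewrite ge0_integralZl; [|exact: mH| | |]; last 3 first.
- apply: emeasurable_funM; last exact: measurable_weight.
  by apply/measurable_EFinP; apply: measurable_indic; apply: mg.
- by move=> z _; rewrite mule_ge0// lee_fin ?powR_ge0.
- by rewrite lee_fin.
congr (_ * _)%E.
rewrite setIC integral_mkcondr; apply: eq_integral => z _.
by rewrite epatch_indic/= muleC.
Qed.

(** The weighted area has density y^beta with respect to the area of the
    half-plane; this moves estimates between different weights. *)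
Lemma ge0_integral_weighted_area (f : R * R -> \bar R) :
  measurable_fun setT f -> (forall z, 0 <= f z)%E ->
  (\int[weighted_area beta]_z f z =
   \int[area]_(z in H) (f z * (z.2 `^ beta)%:E))%E.
Proof.
move=> mf f0; have mH := @measurable_upper_half_plane R.
pose g := nnsfun_approx measurableT mf.
have mg n : measurable_fun setT (EFin \o g n) by exact/measurable_EFinP.
have gnd z m n : (m <= n)%N -> g m z <= g n z.
  by move=> mn; exact/lefP/nd_nnsfun_approx.
have gf z : f z = limn (EFin \o g^~ z).
  by apply/esym/cvg_lim => //; exact: cvg_nnsfun_approx.
under [LHS]eq_integral do rewrite gf.
rewrite monotone_convergence//; last 2 first.
- by move=> n z _; rewrite lee_fin.
- by move=> z _ m n mn; rewrite lee_fin; exact: gnd.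
have gfw z : (f z * (z.2 `^ beta)%:E)%E =
    limn (fun n => (g n z)%:E * (z.2 `^ beta)%:E)%E.
  apply/esym/cvg_lim => //; apply: cvgeZr => //; exact: cvg_nnsfun_approx.
under [RHS]eq_integral do rewrite gfw.
rewrite monotone_convergence//; last 3 first.
- move=> n; apply: emeasurable_funM; last exact: measurable_weight.
  by apply: measurable_funTS; apply: mg.
- by move=> n z _; rewrite mule_ge0// lee_fin ?powR_ge0.
- move=> z _ m n mn; rewrite lee_wpmul2r ?lee_fin ?powR_ge0//.
  exact: gnd.
by congr (limn _); apply/funext => n; exact: integral_weighted_area_nnsfun.
Qed.

(** The density is finite at each point, so the plane is exhausted by sets of
    finite area on which the density is bounded. Tonelli's theorem for weighted
    areas depends on this. *)
Lemma weighted_area_sigma_finite : sigma_finite setT (weighted_area beta).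
Proof.
have mH := @measurable_upper_half_plane R.
have [A AT Afin] := sigma_finiteT (@lebesgue_measure R).
pose B n := [set z : R * R | z.2 `^ beta <= n%:R].
have mB n : measurable (B n).
  have -> : B n = setT `&` (fun z : R * R => z.2 `^ beta) @^-1` `]-oo, n%:R].
    by rewrite setTI; apply/seteqP; split => z; rewrite /B /= in_itv.
  apply: (measurableT_comp (measurable_powR beta) measurable_snd) => //.
have mA i : measurable (A i : set R) by exact: (Afin i).1.
(* One index n encodes two indices of pieces of the line and a bound for the
   density. *)
pose idx (n i : nat) : nat := (CodeSeq.decode n)`_i%N.
pose F n : set (R * R) := (A (idx n 0%N) `*` A (idx n 1%N)) `&` B (idx n 2%N).
exists F.
- apply/esym; rewrite -subTset => z _.
  have [i _ Ai] : (\bigcup_i A i) z.1 by rewrite -AT.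
  have [j _ Aj] : (\bigcup_i A i) z.2 by rewrite -AT.
  exists (CodeSeq.code [:: i; j; Num.bound (z.2 `^ beta)]) => //.
  rewrite /F /idx CodeSeq.codeK/=; split => //; rewrite /B/= ltW//.
  by apply: archi_boundP; exact: powR_ge0.
- move=> n; have [_ A0] := Afin (idx n 0%N); have [_ A1] := Afin (idx n 1%N).
  have mA01 : measurable (A (idx n 0%N) `*` A (idx n 1%N) : set (R * R)).
    by apply: measurableX; exact: mA.
  have mF : measurable (F n) by apply: measurableI; [exact: mA01|exact: mB].
  have mFH : measurable (F n `&` H) by exact: measurableI.
  split => //; rewrite /weighted_area/=.
  apply: (@le_lt_trans _ _ (\int[area]_(z in F n `&` H) ((idx n 2%N)%:R)%:E)%E).
    apply: ge0_le_integral => //=.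
    + by move=> z _; rewrite lee_fin powR_ge0.
    + exact: measurable_weight.
    + by move=> z [[]].
  rewrite integral_cst; last exact: mFH.
  rewrite lte_mul_pinfty//.
  apply: (@le_lt_trans _ _ (area (A (idx n 0%N) `*` A (idx n 1%N)))).
    rewrite le_measure ?inE//.
    by move=> z [[]].
  rewrite product_measure1E; [|exact: mA|exact: mA].
  by apply: lte_mul_pinfty => //; rewrite ge0_fin_numE.
Qed.

HB.instance Definition _ := Measure_isSigmaFinite.Build _ _ _
  (weighted_area beta) weighted_area_sigma_finite.

End weighted_area_theory.

(** * Schur's test *)

Section schur.
Context d (T : measurableType d) (R : realType).
Variable mu : {sigma_finite_measure set T -> \bar R}.

(** Hoelder's inequality raised to the power p, so that it can be integrated
    against another variable. *)
Lemma hoelder_integral_powR (p q : R) (f g : T -> R) :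
  measurable_fun setT f -> measurable_fun setT g ->
  (forall x, 0 <= f x) -> (forall x, 0 <= g x) ->
  0 < p -> 0 < q -> p^-1 + q^-1 = 1 ->
  ((\int[mu]_x (f x * g x)%:E) `^ p <=
   (\int[mu]_x (f x `^ q)%:E) `^ (p / q) * \int[mu]_x (g x `^ p)%:E)%E.
Proof.
move=> mf mg f0 g0 p0 q0 pq.
have := hoelder mu mf mg q0 p0; rewrite addrC => /(_ pq).
rewrite Lnorm1 => h.
have {h} : (\int[mu]_x (f x * g x)%:E <=
    'N[mu]_q%:E[EFin \o f] * 'N[mu]_p%:E[EFin \o g])%E.
  apply: le_trans h; rewrite le_eqVlt; apply/orP; left; apply/eqP.
  by apply: eq_integral => x _ /=; rewrite ger0_norm// mulr_ge0.
move=> h.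
apply: (@le_trans _ _ (('N[mu]_q%:E[EFin \o f] * 'N[mu]_p%:E[EFin \o g]) `^ p)%E).
  apply: gt0_ler_poweR => //; first exact: ltW.
  - by rewrite in_itv/= leey andbT integral_ge0// => x _; rewrite lee_fin mulr_ge0.
  - by rewrite in_itv/= leey andbT mule_ge0// Lnorm_ge0.
rewrite poweRM ?Lnorm_ge0// (poweR_Lnorm _ _ (lt0r_neq0 p0)).
have -> : ('N[mu]_q%:E[EFin \o f] `^ p = (\int[mu]_x (f x `^ q)%:E) `^ (p / q))%E.
  transitivity (('N[mu]_q%:E[EFin \o f] `^ q) `^ (p / q))%E.
    by rewrite -poweRrM; congr (_ `^ _)%E; rewrite mulrCA divff ?mulr1// gt_eqF.
  rewrite (poweR_Lnorm _ _ (lt0r_neq0 q0)); congr (_ `^ _)%E.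
  by apply: eq_integral => x _ /=; rewrite ger0_norm.
apply: lee_wpmul2l; first exact: poweR_ge0.
rewrite (eq_integral (fun x => (g x `^ p)%:E))// => x _ /=.
by rewrite ger0_norm.
Qed.

(** Schur's test. Write k F = (k^(1/q) h) (k^(1/p) F / h). By Hoelder's
    inequality and the first bound, the p-th power of the integral of k F is at
    most C^(p - 1) times the integral of k(z, w) h(z)^p (F / h)(w)^p in w;
    integrating in z, Tonelli's theorem and the second bound give the constant
    C^(p - 1) C. The test function h may vanish where the kernel does. *)
Lemma schur_test (p q C : R) (k : T * T -> R) (h : T -> R) :
  0 < p -> 0 < q -> p^-1 + q^-1 = 1 -> 0 <= C ->
  measurable_fun setT k -> (forall x, 0 <= k x) ->
  measurable_fun setT h -> (forall x, 0 <= h x) ->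
  (forall z w, h w = 0 -> k (z, w) = 0) ->
  (forall z, \int[mu]_w (k (z, w) * h w `^ q)%:E <= (C * h z `^ q)%:E)%E ->
  (forall w, \int[mu]_z (k (z, w) * h z `^ p)%:E <= (C * h w `^ p)%:E)%E ->
  forall F : T -> R, measurable_fun setT F -> (forall x, 0 <= F x) ->
  (\int[mu]_z (\int[mu]_w (k (z, w) * F w)%:E) `^ p <=
   (C `^ p)%:E * \int[mu]_w (F w `^ p)%:E)%E.
Proof.
move=> p0 q0 pq C0 mk k0 mh h0 kh kq kp F mF F0.
have p_neq0 := lt0r_neq0 p0. have q_neq0 := lt0r_neq0 q0.
have pq1 : p / q = p - 1.
  have -> : q^-1 = 1 - p^-1 by rewrite -pq addrC addKr.
  by rewrite mulrBr mulr1 divff.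
have mk1 z : measurable_fun setT (fun w => k (z, w)).
  exact: (measurableT_comp mk (pair1_measurable z)).
pose g w := F w / h w.
have mg : measurable_fun setT g.
  apply: measurable_funM => //.
  have -> : (fun w => (h w)^-1) = (fun w => h w `^ (-1)).
    by apply/funext => w; rewrite powR_inv1.
  exact: (measurableT_comp (measurable_powR _) mh).
have g0 w : 0 <= g w by rewrite divr_ge0.
have step z : ((\int[mu]_w (k (z, w) * F w)%:E) `^ p <=
    \int[mu]_w (C `^ (p - 1) * (k (z, w) * h z `^ p * g w `^ p))%:E)%E.
  have -> : (\int[mu]_w (k (z, w) * F w)%:E =
     \int[mu]_w ((k (z, w) `^ q^-1 * h w) * (k (z, w) `^ p^-1 * g w))%:E)%E.
    apply: eq_integral => w _; congr EFin.
    have [hw|hw] := eqVneq (h w) 0.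
      by rewrite (kh z w hw) hw mul0r mulr0 mul0r.
    rewrite mulrACA -powRD; last by rewrite addrC pq oner_eq0.
    by rewrite addrC pq powRr1// [h w * _]mulrC divfK.
  apply: le_trans.
    apply: (hoelder_integral_powR _ _ _ _ p0 q0 pq).
    - apply: measurable_funM => //.
      exact: (measurableT_comp (measurable_powR _) (mk1 z)).
    - apply: measurable_funM => //.
      exact: (measurableT_comp (measurable_powR _) (mk1 z)).
    - by move=> w; rewrite mulr_ge0// powR_ge0.
    - by move=> w; rewrite mulr_ge0// powR_ge0.
  have -> : (\int[mu]_x ((k (z, x) `^ q^-1 * h x) `^ q)%:E =
      \int[mu]_w (k (z, w) * h w `^ q)%:E)%E.
    apply: eq_integral => w _; congr EFin.
    by rewrite powRM ?powR_ge0// -powRrM mulVf// powRr1.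
  have -> : (\int[mu]_x ((k (z, x) `^ p^-1 * g x) `^ p)%:E =
      \int[mu]_w (k (z, w) * g w `^ p)%:E)%E.
    apply: eq_integral => w _; congr EFin.
    by rewrite powRM ?powR_ge0// -powRrM mulVf// powRr1.
  have -> : (\int[mu]_w (C `^ (p - 1) * (k (z, w) * h z `^ p * g w `^ p))%:E =
      (C `^ (p - 1) * h z `^ p)%:E * \int[mu]_w (k (z, w) * g w `^ p)%:E)%E.
    transitivity (\int[mu]_w ((C `^ (p - 1) * h z `^ p)%:E *
        (k (z, w) * g w `^ p)%:E))%E.
      by apply: eq_integral => w _; rewrite -EFinM; congr EFin; ring.
    apply: ge0_integralZl => //.
    - apply/measurable_EFinP; apply: measurable_funM => //.
      exact: (measurableT_comp (measurable_powR _) mg).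
    - by move=> w _; rewrite lee_fin mulr_ge0// powR_ge0.
    - by rewrite lee_fin mulr_ge0// powR_ge0.
  apply: lee_wpmul2r.
    by apply: integral_ge0 => w _; rewrite lee_fin mulr_ge0// powR_ge0.
  apply: (@le_trans _ _ ((C * h z `^ q)%:E `^ (p / q))%E).
    apply: gt0_ler_poweR => //; first by rewrite divr_ge0// ltW.
    - rewrite in_itv/= leey andbT integral_ge0// => x _.
      by rewrite lee_fin mulr_ge0// powR_ge0.
    - by rewrite in_itv/= leey andbT lee_fin mulr_ge0// powR_ge0.
  rewrite poweR_EFin lee_fin powRM ?powR_ge0// -powRrM.
  by rewrite pq1 -pq1 mulrCA divff// mulr1 pq1.
pose K zw := (C `^ (p - 1) * (k zw * h zw.1 `^ p * g zw.2 `^ p))%:E.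
have mK : measurable_fun setT K.
  apply/measurable_EFinP; apply: measurable_funM => //.
  apply: measurable_funM; first apply: measurable_funM => //.
    by apply: (measurableT_comp (measurable_powR _)); exact: (measurableT_comp mh).
  by apply: (measurableT_comp (measurable_powR _)); exact: (measurableT_comp mg).
have K0 zw : (0 <= K zw)%E by rewrite lee_fin !mulr_ge0 ?powR_ge0.
have mkF : measurable_fun setT (fun zw : T * T => (k zw * F zw.2)%:E).
  apply/measurable_EFinP; apply: measurable_funM => //.
  exact: (measurableT_comp mF).
apply: (@le_trans _ _ (\int[mu]_z \int[mu]_w K (z, w))%E).
  apply: ge0_le_integral => //.
  - by move=> z _; exact: poweR_ge0.
  - apply: (measurableT_comp (measurable_poweR _)).
    apply: (measurable_fun_fubini_tonelli_F _ mkF).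
    by move=> zw; rewrite lee_fin mulr_ge0.
  - exact: (measurable_fun_fubini_tonelli_F _ mK).
rewrite fubini_tonelli//.
rewrite -ge0_integralZl//; last 3 first.
- apply/measurable_EFinP.
  exact: (measurableT_comp (measurable_powR _) mF).
- by move=> w _; rewrite lee_fin powR_ge0.
- by rewrite lee_fin powR_ge0.
apply: ge0_le_integral => //.
- by move=> w _; exact: integral_ge0.
- exact: (measurable_fun_fubini_tonelli_G _ mK).
- apply: measurable_funeM; apply/measurable_EFinP.
  exact: (measurableT_comp (measurable_powR _) mF).
move=> w _; rewrite /K/=.
have -> : (\int[mu]_z (C `^ (p - 1) * (k (z, w) * h z `^ p * g w `^ p))%:E =
    (C `^ (p - 1) * g w `^ p)%:E * \int[mu]_z (k (z, w) * h z `^ p)%:E)%E.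
  transitivity (\int[mu]_z ((C `^ (p - 1) * g w `^ p)%:E *
      (k (z, w) * h z `^ p)%:E))%E.
    by apply: eq_integral => z _; rewrite -EFinM; congr EFin; ring.
  apply: ge0_integralZl => //.
  - apply/measurable_EFinP; apply: measurable_funM => //.
      exact: (measurableT_comp mk (pair2_measurable w)).
    exact: (measurableT_comp (measurable_powR _) mh).
  - by move=> z _; rewrite lee_fin mulr_ge0// powR_ge0.
  - by rewrite lee_fin mulr_ge0// powR_ge0.
apply: (@le_trans _ _ ((C `^ (p - 1) * g w `^ p)%:E * (C * h w `^ p)%:E)%E).
  by apply: lee_wpmul2l => //; rewrite lee_fin mulr_ge0// powR_ge0.
rewrite -!EFinM lee_fin mulrACA [_ `^ _ * C]mulrC mulr_powRB1//.
apply: ler_wpM2l; first exact: powR_ge0.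
rewrite /g powRM// ?invr_ge0//.
have [->|hw] := eqVneq (h w) 0; first by rewrite [X in _ * X]powR0// mulr0 powR_ge0.
rewrite -mulrA -powRM ?invr_ge0// mulVf// powR1 mulr1//.
Qed.

End schur.

(** * Integrals of the kernel over the half-plane *)

Section kernel.
Context (R : realType).
Local Open Scope complex_scope.
Local Notation area := ((@lebesgue_measure R) \x (@lebesgue_measure R))%E.
Local Notation H := (upper_half_plane R).
Local Notation leb := (@lebesgue_measure R).

Lemma integral_powR_dist (x c b : R) : 0 < c -> 1 < b ->
  (\int[leb]_u ((`|x - u| + c) `^ (- b))%:E = (2 * (c `^ (1 - b) / (b - 1)))%:E)%E.
Proof.
move=> c0 b1.
have m : measurable_fun (setT : set R) (fun u => ((`|x - u| + c) `^ (- b))%:E).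
  apply/measurable_EFinP.
  apply: (measurableT_comp (measurable_powR (- b))).
  apply: measurable_funD => //; apply: (measurableT_comp (@normr_measurable _ _)).
  exact: measurable_funB.
have nn u : (0 <= ((`|x - u| + c) `^ (- b))%:E)%E by rewrite lee_fin powR_ge0.
have -> : [set: R] = `]-oo, x]%classic `|` `]x, +oo[%classic.
  apply/esym/seteqP; split => // u _; rewrite /= !in_itv/= andbT.
  by case: (leP u x); [left|right].
rewrite ge0_integral_setU//=; last 2 first.
- exact: measurable_funTS.
- apply/disj_setPS => u []; rewrite /= !in_itv/= andbT => ux xu.
  by move: (lt_le_trans xu ux); rewrite ltxx.
rewrite integral_itv_obnd_cbnd; last exact: measurable_funTS.
rewrite (@eq_integral _ _ _ leb `]-oo, x]%classic
  (fun u => ((x + c - u) `^ (- b))%:E)); last first.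
  move=> u; rewrite inE/= in_itv/= => ux.
  by rewrite ger0_norm ?subr_ge0// addrAC.
rewrite (@eq_integral _ _ _ leb `[x, +oo[%classic
  (fun u => ((u + (c - x)) `^ (- b))%:E)); last first.
  move=> u; rewrite inE/= in_itv/= andbT => ux.
  by rewrite distrC ger0_norm ?subr_ge0//; congr ((_ `^ _)%:E); ring.
have xcx : x + c - x = c by ring.
have xcx' : x + (c - x) = c by ring.
rewrite integral_powR_bndNy ?xcx// integral_powR_shifty ?xcx'//.
by rewrite -EFinD; congr EFin; ring.
Qed.

(** Below y the factor (y + v)^(-b) is at most y^(-b), above y it is at most
    v^(-b); both pieces are then integrals of powers, convergent at 0 because
    a > -1 and at infinity because b > a + 1. *)
Lemma integral_powR_mul_shift (a b y : R) : -1 < a -> a + 1 < b -> 0 < y ->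
  (\int[leb]_(v in `]0%R, +oo[) (v `^ a * (y + v) `^ (- b))%:E <=
   (((a + 1)^-1 + (b - a - 1)^-1) * y `^ (a + 1 - b))%:E)%E.
Proof.
move=> a1 ab y0; have b0 : 0 < b by lra.
have m : measurable_fun (setT : set R) (fun v => (v `^ a * (y + v) `^ (- b))%:E).
  apply/measurable_EFinP; apply: measurable_funM; first exact: measurable_powR.
  apply: (measurableT_comp (measurable_powR (- b))).
  exact: measurable_funD.
have nn v : (0 <= (v `^ a * (y + v) `^ (- b))%:E)%E.
  by rewrite lee_fin mulr_ge0// powR_ge0.
have -> : `]0%R, +oo[%classic = `]0%R, y]%classic `|` `]y, +oo[%classic :> set R.
  apply/seteqP; split => v; rewrite /= !in_itv/= !andbT.
    by move=> v0; case: (leP v y); [left; rewrite v0|right].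
  by case=> [/andP[]//|]; exact: lt_trans.
rewrite ge0_integral_setU//=; last 2 first.
- exact: measurable_funTS.
- apply/disj_setPS => u []; rewrite /= !in_itv/= andbT => /andP[_ ux] xu.
  by move: (lt_le_trans xu ux); rewrite ltxx.
rewrite mulrDl EFinD; apply: leeD.
- apply: (@le_trans _ _ (\int[leb]_(v in `]0%R, y]) ((y `^ (- b))%:E * (v `^ a)%:E))%E).
    apply: ge0_le_integral => //=.
    + exact: measurable_funTS.
    + apply: measurable_funeM; apply/measurable_EFinP; apply: measurable_funTS.
      exact: measurable_powR.
    + move=> v; rewrite in_itv/= => /andP[v0 vy].
      rewrite -EFinM lee_fin mulrC ler_wpM2r ?powR_ge0//.
      rewrite !powRN lef_pV2 ?posrE ?powR_gt0//; last by rewrite addr_gt0.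
      by apply: ge0_ler_powR; rewrite ?nnegrE ?ltW// ?addr_gt0// ltrDl.
  rewrite ge0_integralZl//=; last 3 first.
  + apply/measurable_EFinP; apply: measurable_funTS.
    exact: measurable_powR.
  + by move=> v _; rewrite lee_fin powR_ge0.
  + by rewrite lee_fin powR_ge0.
  rewrite integral_powR0// -EFinM lee_fin mulrA -powRD ?(gt_eqF y0) ?implybT//.
  rewrite mulrC le_eqVlt; apply/orP; left; apply/eqP.
  by congr (_ * _ `^ _); ring.
- rewrite integral_itv_obnd_cbnd; last exact: measurable_funTS.
  apply: (@le_trans _ _ (\int[leb]_(v in `[y, +oo[) ((v + 0) `^ (- (b - a)))%:E)%E).
    apply: ge0_le_integral => //=.
    + exact: measurable_funTS.
    + apply/measurable_EFinP; apply: measurable_funTS.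
      apply: (measurableT_comp (measurable_powR _)).
      exact: measurable_funD.
    + move=> v; rewrite in_itv/= andbT => yv.
      have v0 : 0 < v by exact: lt_le_trans yv.
      rewrite lee_fin addr0 opprB powRD ?(gt_eqF v0) ?implybT//.
      rewrite ler_wpM2l ?powR_ge0//.
      rewrite !powRN lef_pV2 ?posrE ?powR_gt0//; last by rewrite addr_gt0.
      by apply: ge0_ler_powR; rewrite ?nnegrE ?ltW// ?addr_gt0// ltrDr.
  rewrite integral_powR_shifty ?addr0//; last by lra.
  rewrite lee_fin mulrC le_eqVlt; apply/orP; left; apply/eqP.
  by congr (_ * _ `^ _); ring.
Qed.

Lemma normc_sub_conj (z w : R * R) :
  normc (toC z - (toC w)^*) = Num.sqrt ((z.1 - w.1) ^+ 2 + (z.2 + w.2) ^+ 2).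
Proof. by rewrite /toC /= opprK. Qed.

(** The Euclidean norm of (x - u, y + v) dominates the mean of the moduli of its
    coordinates; the latter makes the kernel integrable in closed form. *)
Lemma normc_sub_conj_ge (z w : R * R) : H z -> H w ->
  (`|z.1 - w.1| + (z.2 + w.2)) / 2 <= normc (toC z - (toC w)^*).
Proof.
move=> z0 w0; rewrite normc_sub_conj; rewrite /upper_half_plane/= in z0 w0.
have zw0 : 0 < z.2 + w.2 by rewrite addr_gt0.
rewrite -[leLHS]ger0_norm; last by rewrite divr_ge0// addr_ge0// ltW.
rewrite -sqrtr_sqr ler_wsqrtr// -(real_normK (num_real (z.1 - w.1))).
set d := `|_|; set t := _ + _ in zw0 *; have : 0 <= (d - t) ^+ 2 by exact: sqr_ge0.
by nra.
Qed.

Lemma normc_sub_conj_gt0 (z w : R * R) : H z -> H w ->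
  0 < normc (toC z - (toC w)^*).
Proof.
move=> z0 w0; apply: lt_le_trans (normc_sub_conj_ge z0 w0).
by rewrite divr_gt0// ltr_wpDl// addr_gt0.
Qed.

Lemma measurable_normc_sub_conj :
  measurable_fun setT
    (fun zw : (R * R) * (R * R) => normc (toC zw.1 - (toC zw.2)^*)).
Proof.
rewrite (_ : (fun _ => _) = (fun zw : (R * R) * (R * R) =>
    ((zw.1.1 - zw.2.1) ^+ 2 + (zw.1.2 + zw.2.2) ^+ 2) `^ (2^-1))); last first.
  apply/funext => zw; rewrite normc_sub_conj powR12_sqrt//.
  by rewrite addr_ge0// sqr_ge0.
apply: (measurableT_comp (measurable_powR _)).
apply: measurable_funD; apply: measurable_funX.
- apply: measurable_funB.
    exact: (measurableT_comp measurable_fst measurable_fst).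
  exact: (measurableT_comp measurable_fst measurable_snd).
- apply: measurable_funD.
    exact: (measurableT_comp measurable_snd measurable_fst).
  exact: (measurableT_comp measurable_snd measurable_snd).
Qed.

(** The factors come, in this order, from the lower bound of the distance, from
    the integral over a horizontal line and from the remaining vertical
    integral. *)
Definition half_plane_kernel_const (a b : R) : R :=
  2 `^ b * (2 / (b - 1)) * ((a + 1)^-1 + (b - a - 2)^-1).

(** After the lower bound of the distance, the integral over a horizontal line
    gives (y + v)^(1 - b), and the vertical integral of v^a (y + v)^(1 - b) is a
    multiple of y^(a + 2 - b). *)
Lemma integral_half_plane_kernel (a b : R) (z : R * R) :
  -1 < a -> a + 2 < b -> H z ->
  (\int[area]_(w in H) (normc (toC z - (toC w)^*) `^ (- b) * w.2 `^ a)%:E <=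
   (half_plane_kernel_const a b * z.2 `^ (a + 2 - b))%:E)%E.
Proof.
move=> a1 ab Hz; have y0 : 0 < z.2 by [].
have b1 : 1 < b by lra.
(* An integrand on the whole plane, as Tonelli's theorem is for products. *)
pose phi (w : R * R) := (\1_(`]0%R, +oo[%classic : set R) w.2 *
  (2 `^ b * (`|z.1 - w.1| + (z.2 + w.2)) `^ (- b) * w.2 `^ a))%:E.
have phi0 w : (0 <= phi w)%E by rewrite lee_fin !mulr_ge0// powR_ge0.
have mphi : measurable_fun setT phi.
  apply/measurable_EFinP; apply: measurable_funM.
    exact: (measurableT_comp (measurable_indic _) measurable_snd).
  apply: measurable_funM; last first.
    exact: (measurableT_comp (measurable_powR _) measurable_snd).
  apply: measurable_funM => //.
  apply: (measurableT_comp (measurable_powR _)).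
  apply: measurable_funD.
    apply: (measurableT_comp (@normr_measurable _ _)).
    by apply: measurable_funB => //; exact: measurable_fst.
  by apply: measurable_funD => //; exact: measurable_snd.
apply: (@le_trans _ _ (\int[area]_w phi w)%E).
  rewrite [leLHS]integral_mkcond; apply: ge0_le_integral => //=.
  - by move=> w _; apply: erestrict_ge0 => v _; rewrite lee_fin mulr_ge0// powR_ge0.
  - apply/(measurable_restrictT _ _).1 => //; first exact: measurable_upper_half_plane.
    apply/measurable_EFinP; apply: measurable_funTS; apply: measurable_funM.
      apply: (measurableT_comp (measurable_powR _)).
      exact: (measurableT_comp measurable_normc_sub_conj (pair1_measurable z)).
    exact: (measurableT_comp (measurable_powR _) measurable_snd).
  - move=> w _; rewrite patchE; case: ifPn => // /set_mem Hw.
    have w0 : 0 < w.2 by [].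
    have := normc_sub_conj_ge Hz Hw; have := normc_sub_conj_gt0 Hz Hw.
    set N := normc _ => N0 SN.
    rewrite lee_fin indicE mem_set/= ?in_itv/= ?andbT// mul1r.
    apply: ler_wpM2r; first exact: powR_ge0.
    set S := _ + _ in SN *.
    have S0 : 0 < S by rewrite ltr_wpDl// addr_gt0.
    have -> : 2 `^ b * S `^ (- b) = (S / 2) `^ (- b).
      rewrite powRM ?ltW// mulrC; congr (_ * _).
      by rewrite -powR_inv1// -powRrM mulN1r opprK.
    have S20 : 0 < S / 2 by rewrite divr_gt0.
    rewrite !powRN lef_pV2 ?posrE ?powR_gt0//.
    by apply: ge0_ler_powR; rewrite ?nnegrE ?(ltW N0) ?(ltW S20)//; lra.
rewrite fubini_tonelli2//.
apply: (@le_trans _ _ (\int[leb]_(v in `]0%R, +oo[) ((2 `^ b * (2 / (b - 1)))%:E *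
   (v `^ a * (z.2 + v) `^ (- (b - 1)))%:E))%E).
  rewrite [leRHS]integral_mkcond le_eqVlt; apply/orP; left; apply/eqP.
  apply: eq_integral => v _; rewrite /fubini_G /phi /= patchE indicE.
  case: ifPn => [|_]; last by under eq_integral do rewrite mul0r; rewrite integral0.
  rewrite inE/= in_itv/= andbT => v0.
  under eq_integral do rewrite mul1r mulrAC EFinM.
  rewrite ge0_integralZl//=.
  - rewrite integral_powR_dist//; last exact: addr_gt0.
    by rewrite -!EFinM opprB; congr EFin; ring.
  - apply/measurable_EFinP.
    apply: (measurableT_comp (measurable_powR (- b))).
    apply: measurable_funD => //; apply: (measurableT_comp (@normr_measurable _ _)).
    exact: measurable_funB.
  - by move=> u _; rewrite lee_fin powR_ge0.
  - by rewrite lee_fin mulr_ge0// powR_ge0.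
have K0 : 0 <= 2 `^ b * (2 / (b - 1)).
  by rewrite mulr_ge0 ?powR_ge0// divr_ge0// subr_ge0 ltW.
rewrite ge0_integralZl//=; last 2 first.
- apply/measurable_EFinP; apply: measurable_funTS; apply: measurable_funM.
    exact: measurable_powR.
  apply: (measurableT_comp (measurable_powR _)).
  exact: measurable_funD.
- by move=> v _; rewrite lee_fin mulr_ge0// powR_ge0.
apply: (@le_trans _ _ ((2 `^ b * (2 / (b - 1)))%:E * (((a + 1)^-1 + (b - 1 - a - 1)^-1) *
  z.2 `^ (a + 1 - (b - 1)))%:E)%E).
  by apply: lee_wpmul2l => //; apply: integral_powR_mul_shift => //; lra.
rewrite -EFinM lee_fin /half_plane_kernel_const -!mulrA le_eqVlt.
apply/orP; left; apply/eqP; congr (_ * (_ * (_ * ((_ + _^-1) * _ `^ _)))); ring.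
Qed.

End kernel.

(** * The positive operator on nonnegative functions *)

Section positive.
Context (R : realType).
Local Open Scope complex_scope.
Local Notation H := (upper_half_plane R).

(** The indicator functions keep the kernel at 0 off the half-plane, so that
    integrals over the plane and bounds at all points can be used. *)
Definition abs_kernel (s : R) (zw : (R * R) * (R * R)) : R :=
  \1_H zw.1 * \1_H zw.2 * normc (toC zw.1 - (toC zw.2)^*) `^ (- s).

Lemma abs_kernel_ge0 s zw : 0 <= abs_kernel s zw.
Proof. by rewrite !mulr_ge0// powR_ge0. Qed.

Lemma abs_kernelE s z w : H z -> H w ->
  abs_kernel s (z, w) = normc (toC z - (toC w)^*) `^ (- s).
Proof. by move=> Hz Hw; rewrite /abs_kernel !indicE !mem_set// !mul1r. Qed.

Lemma abs_kernel_eq0 s z w : ~ (H z /\ H w) -> abs_kernel s (z, w) = 0.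
Proof.
move=> zw; rewrite /abs_kernel !indicE; case: (boolP (z \in H)) => [/set_mem Hz|_].
  by rewrite memNset ?mulr0 ?mul0r// => Hw; exact: zw.
by rewrite !mul0r.
Qed.

Lemma measurable_abs_kernel s : measurable_fun setT (abs_kernel s).
Proof.
have mH : measurable H by exact: measurable_upper_half_plane.
apply: measurable_funM.
  apply: measurable_funM.
    exact: (measurableT_comp (@measurable_indic _ _ R setT H mH) measurable_fst).
  exact: (measurableT_comp (@measurable_indic _ _ R setT H mH) measurable_snd).
exact: (measurableT_comp (measurable_powR _) (@measurable_normc_sub_conj R)).
Qed.

Lemma abs_kernelC s z w : abs_kernel s (z, w) = abs_kernel s (w, z).
Proof.
rewrite /abs_kernel !normc_sub_conj [\1_H (z, w).1 * _]mulrC.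
by congr (_ * Num.sqrt _ `^ _) => /=; ring.
Qed.

Lemma powR_abs_kernel s q zw : q != 0 ->
  abs_kernel s zw `^ q = abs_kernel (s * q) zw.
Proof.
move=> q0; case: zw => z w; have [[Hz Hw]|nzw] := pselect (H z /\ H w).
  by rewrite !abs_kernelE// -powRrM mulNr.
by rewrite !abs_kernel_eq0// powR0.
Qed.

Lemma half_plane_kernel_const_ge0 (a b : R) :
  -1 < a -> a + 2 < b -> 0 <= half_plane_kernel_const a b.
Proof.
move=> a1 ab; rewrite !mulr_ge0 ?powR_ge0 ?invr_ge0//; first lra.
by rewrite addr_ge0// invr_ge0; lra.
Qed.

(** The kernel estimate, with a part y^alpha of the weight in the measure. *)
Lemma abs_kernel_moment (alpha b c : R) (z : R * R) :
  -1 < alpha + c -> alpha + c + 2 < b ->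
  (\int[weighted_area alpha]_w (abs_kernel b (z, w) * w.2 `^ c)%:E <=
   (half_plane_kernel_const (alpha + c) b * z.2 `^ (alpha + c + 2 - b))%:E)%E.
Proof.
move=> ac1 acb.
have [Hz|nHz] := pselect (H z); last first.
  rewrite integral0_eq => [|w _]; last by rewrite abs_kernel_eq0 ?mul0r// => -[].
  rewrite lee_fin mulr_ge0 ?powR_ge0//.
  exact: half_plane_kernel_const_ge0.
rewrite ge0_integral_weighted_area; last 2 first.
- apply/measurable_EFinP; apply: measurable_funM.
    exact: (measurableT_comp (measurable_abs_kernel b) (pair1_measurable z)).
  exact: (measurableT_comp (measurable_powR _) measurable_snd).
- by move=> w; rewrite lee_fin mulr_ge0 ?powR_ge0// abs_kernel_ge0.
apply: le_trans (integral_half_plane_kernel ac1 acb Hz).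
rewrite le_eqVlt; apply/orP; left; apply/eqP.
apply: eq_integral => w /set_mem Hw; rewrite -EFinM abs_kernelE//.
have w0 : 0 < w.2 by [].
by rewrite -mulrA -powRD ?[c + _]addrC// (gt_eqF w0) implybT.
Qed.

(** The positive operator on nonnegative functions. Values in the extended reals
    allow Tonelli's theorem before finiteness is known. *)
Definition positive_potential (alpha : R) (F : R * R -> R) (z : R * R) : \bar R :=
  (\int[weighted_area alpha]_w (abs_kernel (2 + alpha) (z, w) * F w)%:E)%E.

Lemma measurable_positive_potential alpha (F : R * R -> R) :
  measurable_fun setT F -> (forall w, 0 <= F w) ->
  measurable_fun setT (positive_potential alpha F).
Proof.
move=> mF F0.
apply: (measurable_fun_fubini_tonelli_F
  (fun zw => (abs_kernel (2 + alpha) zw * F zw.2)%:E)).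
  apply/measurable_EFinP; apply: measurable_funM.
    exact: measurable_abs_kernel.
  exact: (measurableT_comp mF measurable_snd).
by move=> zw; rewrite lee_fin mulr_ge0// abs_kernel_ge0.
Qed.

Lemma positive_potential_ge0 alpha (F : R * R -> R) z : (forall w, 0 <= F w) ->
  (0 <= positive_potential alpha F z)%E.
Proof.
move=> F0; apply: integral_ge0 => w _.
by rewrite lee_fin mulr_ge0// abs_kernel_ge0.
Qed.

(** Schur's test with h = y^(-t). The two moments of the kernel are those of
    y^(-t r) for r = p and r = q, where q is the exponent conjugate to p; they
    are finite, and proportional to y^(-t r), when 0 < t r < alpha + 1. The choice
    t = (alpha + 1) / (p q) gives t p = (alpha + 1) / q and t q = (alpha + 1) / p,
    which satisfy this as p and q are greater than 1. *)
Lemma positive_potential_Lp (alpha p : R) : -1 < alpha -> 1 < p ->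
  exists2 C : R, 0 <= C & forall F : R * R -> R,
    measurable_fun setT F -> (forall w, 0 <= F w) ->
  (\int[weighted_area alpha]_z (positive_potential alpha F z `^ p) <=
   C%:E * \int[weighted_area alpha]_w (F w `^ p)%:E)%E.
Proof.
move=> a1 p1.
have p0 : 0 < p by lra.
pose q := p / (p - 1).
have q0 : 0 < q by rewrite divr_gt0// subr_gt0.
have pq : p^-1 + q^-1 = 1 by rewrite /q invf_div mulrBl divff ?gt_eqF// mul1r; ring.
pose t := (alpha + 1) / (p * q).
have tp : t * p = (alpha + 1) / q by rewrite /t; field; rewrite ?gt_eqF.
have tq : t * q = (alpha + 1) / p by rewrite /t; field; rewrite ?gt_eqF.
have e r : 0 < r -> r^-1 < 1 -> 0 < (alpha + 1) / r < alpha + 1.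
  move=> r0 r1; rewrite divr_gt0//=; last lra.
  by rewrite gtr_pMr//; lra.
have ip : p^-1 < 1 by rewrite invf_lt1.
have iq : q^-1 < 1 by rewrite -pq -subr_gt0 addrK invr_gt0.
have /andP[tp0 tp1] := e _ q0 iq; have /andP[tq0 tq1] := e _ p0 ip.
rewrite -tp in tp0 tp1; rewrite -tq in tq0 tq1.
pose Cp := half_plane_kernel_const (alpha - t * p) (2 + alpha).
pose Cq := half_plane_kernel_const (alpha - t * q) (2 + alpha).
have Cp0 : 0 <= Cp by apply: half_plane_kernel_const_ge0; lra.
have Cq0 : 0 <= Cq by apply: half_plane_kernel_const_ge0; lra.
have M r : 0 < t * r -> t * r < alpha + 1 -> forall z,
    (\int[weighted_area alpha]_w
       (abs_kernel (2 + alpha) (z, w) * (w.2 `^ (- t)) `^ r)%:E <=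
     (half_plane_kernel_const (alpha - t * r) (2 + alpha) * (z.2 `^ (- t)) `^ r)%:E)%E.
  move=> r0 r1 z; under eq_integral do rewrite -powRrM mulNr.
  apply: le_trans.
    by apply: (@abs_kernel_moment alpha (2 + alpha) (- (t * r)) z); lra.
  rewrite lee_fin -powRrM mulNr le_eqVlt; apply/orP; left; apply/eqP.
  by congr (_ * _ `^ _); ring.
(* The sum serves as a common constant for both moments. *)
exists ((Cp + Cq) `^ p); first exact: powR_ge0.
move=> F mF F0.
apply: (@schur_test _ _ _ (weighted_area alpha) p q (Cp + Cq)
  (abs_kernel (2 + alpha)) (fun z => z.2 `^ (- t))) => //.
- exact: addr_ge0.
- exact: measurable_abs_kernel.
- exact: abs_kernel_ge0.
- exact: (measurableT_comp (measurable_powR _) measurable_snd).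
- by move=> z; exact: powR_ge0.
- move=> z w /powR_eq0_eq0 w0; apply: abs_kernel_eq0 => -[_].
  by rewrite /upper_half_plane/= w0 ltxx.
- move=> z; apply: le_trans (M q tq0 tq1 z) _.
  by rewrite lee_fin ler_wpM2r ?powR_ge0// lerDr.
- move=> w; under eq_integral do rewrite abs_kernelC.
  apply: le_trans (M p tp0 tp1 w) _.
  by rewrite lee_fin ler_wpM2r ?powR_ge0// lerDl.
Qed.

(** Hoelder's inequality: with q conjugate to p and s = 2 + alpha, the q-th power
    of the kernel is the kernel of exponent s q, whose integral is a multiple of
    y^(s - s q), and (s - s q) / q = - s / p. *)
Lemma positive_potential_pointwise (alpha p : R) : -1 < alpha -> 1 < p ->
  exists2 C : R, 0 <= C & forall F : R * R -> R,
    measurable_fun setT F -> (forall w, 0 <= F w) -> forall z, H z ->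
  (positive_potential alpha F z <=
   (C * z.2 `^ (- ((2 + alpha) / p)))%:E *
   'N[weighted_area alpha]_p%:E[EFin \o F])%E.
Proof.
move=> a1 p1.
have p0 : 0 < p by lra.
pose q := p / (p - 1).
have q0 : 0 < q by rewrite divr_gt0// subr_gt0.
have pq : p^-1 + q^-1 = 1 by rewrite /q invf_div mulrBl divff ?gt_eqF// mul1r; ring.
have q1 : 1 < q by rewrite /q ltr_pdivlMr ?subr_gt0//; lra.
pose C := half_plane_kernel_const alpha ((2 + alpha) * q).
have aq : alpha + 2 < (2 + alpha) * q by nra.
have C0 : 0 <= C by exact: half_plane_kernel_const_ge0.
exists (C `^ q^-1); first exact: powR_ge0.
move=> F mF F0 z Hz.
have mk : measurable_fun setT (fun w => abs_kernel (2 + alpha) (z, w)).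
  exact: (measurableT_comp (measurable_abs_kernel _) (pair1_measurable z)).
have := @hoelder _ _ _ (weighted_area alpha) _ _ q p mk mF q0 p0.
rewrite addrC => /(_ pq).
rewrite Lnorm1 => h.
apply: (@le_trans _ _ ('N[weighted_area alpha]_q%:E[EFin \o
   (fun w => abs_kernel (2 + alpha) (z, w))] *
   'N[weighted_area alpha]_p%:E[EFin \o F])%E).
  apply: le_trans h; rewrite le_eqVlt; apply/orP; left; apply/eqP.
  apply: eq_integral => w _ /=.
  by rewrite ger0_norm// mulr_ge0// abs_kernel_ge0.
apply: lee_wpmul2r; first exact: Lnorm_ge0.
have -> : (C `^ q^-1 * z.2 `^ (- ((2 + alpha) / p)))%:E =
    ((C * z.2 `^ (alpha + 0 + 2 - (2 + alpha) * q))%:E `^ q^-1)%E.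
  rewrite poweR_EFin powRM// ?powR_ge0// -powRrM; congr ((_ * _ `^ _)%:E).
  have -> : p^-1 = 1 - q^-1 by rewrite -pq addrK.
  by field; rewrite gt_eqF.
rewrite unlock; apply: gt0_ler_poweR.
- by rewrite invr_ge0 ltW.
- rewrite in_itv/= leey andbT; apply: integral_ge0 => w _.
  by rewrite lee_fin powR_ge0.
- by rewrite in_itv/= leey andbT lee_fin mulr_ge0// powR_ge0.
have aq' : alpha + 0 + 2 < (2 + alpha) * q by rewrite addr0.
have a0 : -1 < alpha + 0 by rewrite addr0.
apply: le_trans (le_trans (@abs_kernel_moment alpha ((2 + alpha) * q) 0 z a0 aq') _).
  rewrite le_eqVlt; apply/orP; left; apply/eqP; apply: eq_integral => w _.
  rewrite powRr0 mulr1 -powR_abs_kernel ?gt_eqF//= ger0_norm//.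
  exact: abs_kernel_ge0.
by rewrite /C addr0.
Qed.

End positive.

Section LpLq.
Context (R : realType).
Local Open Scope complex_scope.
Local Notation H := (upper_half_plane R).

(** Interpolation of the L^p bound with the pointwise bound: the factor G^(q - p)
    is at most a constant times y^(- (2 + alpha) (q - p) / p), and this power of y
    times the target weight is y^alpha. *)
Lemma positive_potential_Lp_Lq (alpha p q : R) :
  -1 < alpha -> 1 < p -> p <= q ->
  exists2 C : R, 0 <= C & forall F : R * R -> R,
    measurable_fun setT F -> (forall w, 0 <= F w) ->
    ('N[weighted_area alpha]_p%:E[EFin \o F] < +oo)%E ->
    (forall z, H z -> (positive_potential alpha F z < +oo)%E) /\
    (\int[weighted_area (alpha + (2 + alpha) * (q / p - 1))]_z
        (positive_potential alpha F z `^ q) <=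
     (C%:E * 'N[weighted_area alpha]_p%:E[EFin \o F]) `^ q)%E.
Proof.
move=> a1 p1 pq.
have p0 : 0 < p by lra.
have q0 : 0 < q by lra.
have qp0 : 0 <= q - p by lra.
have [A A0 pointwise] := positive_potential_pointwise a1 p1.
have [B B0 strong] := positive_potential_Lp a1 p1.
exists ((A `^ (q - p) * B) `^ q^-1); first exact: powR_ge0.
move=> F mF F0 Nfin; set beta := alpha + _.
have {strong} := strong F mF F0; have {pointwise} := pointwise F mF F0.
have := @poweR_Lnorm _ _ _ (weighted_area alpha) (EFin \o F) p (lt0r_neq0 p0).
have N0 := @Lnorm_ge0 _ _ _ (weighted_area alpha) p%:E (EFin \o F).
move: N0 Nfin; case: ('N[weighted_area alpha]_p%:E[EFin \o F])%E => // n.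
rewrite lee_fin => n0 _ Np.
have -> : (\int[weighted_area alpha]_w (F w `^ p)%:E = (n `^ p)%:E)%E.
  rewrite -poweR_EFin Np; apply: eq_integral => w _ /=.
  by rewrite ger0_norm.
set G := positive_potential alpha F.
have G0 z : (0 <= G z)%E by exact: positive_potential_ge0.
have mG : measurable_fun setT G by exact: measurable_positive_potential.
have mGr r : measurable_fun setT (fun z => G z `^ r)%E.
  exact: (measurableT_comp (measurable_poweR _) mG).
move=> pointwise strong.
split=> [z Hz|].
  by apply: le_lt_trans (pointwise z Hz) _; rewrite -EFinM ltry.
have mGw r b : measurable_fun H (fun z => G z `^ r * (z.2 `^ b)%:E)%E.
  by apply: emeasurable_funM; [exact: measurable_funTS|exact: measurable_weight].
have -> : ((((A `^ (q - p) * B) `^ q^-1)%:E * n%:E) `^ q =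
    ((A * n) `^ (q - p))%:E * (B%:E * (n `^ p)%:E))%E.
  rewrite -!EFinM poweR_EFin; congr EFin.
  rewrite [LHS]powRM ?powR_ge0// -powRrM mulVf ?gt_eqF// powRr1; last first.
    by rewrite mulr_ge0// powR_ge0.
  have -> : n `^ q = n `^ (q - p) * n `^ p.
    by rewrite -powRD subrK// (gt_eqF q0).
  by rewrite powRM//; ring.
apply: (@le_trans _ _ (((A * n) `^ (q - p))%:E *
    \int[weighted_area alpha]_z (G z `^ p))%E); last first.
  by apply: lee_wpmul2l => //; rewrite lee_fin powR_ge0.
rewrite !ge0_integral_weighted_area//; try by move=> z; exact: poweR_ge0.
rewrite -ge0_integralZl//=; last 4 first.
- by apply: measurable_upper_half_plane.
- by apply: mGw.
- by move=> z _; rewrite mule_ge0// ?poweR_ge0// lee_fin powR_ge0.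
- by rewrite lee_fin powR_ge0.
apply: ge0_le_integral => //=.
- by apply: measurable_upper_half_plane.
- by move=> z _; rewrite mule_ge0// ?poweR_ge0// lee_fin powR_ge0.
- by apply: mGw.
- apply: measurable_funeM.
  by apply: mGw.
move=> z Hz.
have y0 : 0 < z.2 by [].
have := pointwise z Hz; have := G0 z.
case: (G z) => // g; rewrite lee_fin => g0.
rewrite -EFinM lee_fin !poweR_EFin => gle.
rewrite -!EFinM lee_fin.
have -> : g `^ q = g `^ (q - p) * g `^ p.
  by rewrite -powRD subrK// (gt_eqF q0).
have -> : z.2 `^ alpha = (z.2 `^ (- ((2 + alpha) / p))) `^ (q - p) * z.2 `^ beta.
  rewrite -powRrM -powRD ?(gt_eqF y0) ?implybT//; congr (_ `^ _).
  by rewrite /beta; field; rewrite gt_eqF.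
have : g `^ (q - p) <= (A * n) `^ (q - p) * (z.2 `^ (- ((2 + alpha) / p))) `^ (q - p).
  rewrite -powRM ?mulr_ge0 ?powR_ge0//.
  apply: ge0_ler_powR => //; rewrite ?nnegrE ?mulr_ge0 ?powR_ge0//.
  by rewrite mulrAC.
move=> {}gle.
have gp := powR_ge0 g p; have yb := powR_ge0 z.2 beta.
rewrite [leLHS](_ : _ = g `^ (q - p) * (g `^ p * z.2 `^ beta)); last by ring.
apply: le_trans (ler_wpM2r (mulr_ge0 gp yb) gle) _.
by rewrite le_eqVlt; apply/orP; left; apply/eqP; ring.
Qed.

End LpLq.

(** * Complex-valued functions *)

Section complex_wrap.
Context (R : realType).
Local Open Scope complex_scope.
Local Notation H := (upper_half_plane R).

Lemma normc_ge0 (x : R[i]) : 0 <= normc x.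
Proof. by case: x => a b; exact: sqrtr_ge0. Qed.

Lemma normc_ge_Re_abs (x : R[i]) : `|complex.Re x| <= normc x.
Proof.
by case: x => a b /=; rewrite -sqrtr_sqr ler_wsqrtr// lerDl sqr_ge0.
Qed.

Lemma normc_ge_Im_abs (x : R[i]) : `|complex.Im x| <= normc x.
Proof.
by case: x => a b /=; rewrite -sqrtr_sqr ler_wsqrtr// lerDr sqr_ge0.
Qed.

Lemma normc_le_ReIm (x : R[i]) : normc x <= `|complex.Re x| + `|complex.Im x|.
Proof.
case: x => a b /=.
rewrite -[leRHS]ger0_norm ?addr_ge0// -sqrtr_sqr ler_wsqrtr//.
rewrite sqrrD -[a ^+ 2]real_normK ?num_real// -[b ^+ 2]real_normK ?num_real//.
by rewrite lerD2r lerDl mulrn_wge0// mulr_ge0.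
Qed.

Lemma measurable_normc d (T : measurableType d) (D : set T) (f : T -> R[i]) :
  cmeasurable_fun D f -> measurable_fun D (fun x => normc (f x)).
Proof.
move=> [mRe mIm].
rewrite (_ : (fun _ => _) = (fun x =>
    (complex.Re (f x) ^+ 2 + complex.Im (f x) ^+ 2) `^ 2^-1)).
  apply: (measurableT_comp (measurable_powR _)).
  by apply: measurable_funD; exact: measurable_funX.
by apply/funext => x; case: (f x) => a b; rewrite powR12_sqrt// addr_ge0// sqr_ge0.
Qed.

(** A signed density dominated by F; below it is the real or the imaginary part
    of a complex-valued function. *)
Section signed.
Variables (alpha : R) (F r : R * R -> R).
Hypotheses (mF : measurable_fun setT F) (mr : measurable_fun setT r).
Hypothesis rF : forall w, `|r w| <= F w.
Let k := abs_kernel (2 + alpha).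

Let mkr : measurable_fun setT (fun zw : (R * R) * (R * R) => (k zw * r zw.2)%:E).
Proof.
apply/measurable_EFinP; apply: measurable_funM; first exact: measurable_abs_kernel.
exact: (measurableT_comp mr measurable_snd).
Qed.

Let mkr1 z : measurable_fun setT (fun w => (k (z, w) * r w)%:E).
Proof. exact: (measurableT_comp mkr (pair1_measurable z)). Qed.

Lemma potential_abs_le z :
  (\int[weighted_area alpha]_w `|(k (z, w) * r w)%:E| <=
   positive_potential alpha F z)%E.
Proof.
apply: ge0_le_integral => //.
- exact: measurableT_comp.
- apply/measurable_EFinP; apply: measurable_funM => //.
  exact: (measurableT_comp (measurable_abs_kernel _) (pair1_measurable z)).
- move=> w _; rewrite lee_fin normrM ger0_norm ?abs_kernel_ge0//.
  by apply: ler_wpM2l; rewrite ?abs_kernel_ge0.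
Qed.

Lemma integrable_potential z : (positive_potential alpha F z < +oo)%E ->
  (weighted_area alpha).-integrable setT (fun w => (k (z, w) * r w)%:E).
Proof.
move=> h; apply/integrableP; split=> //.
exact: le_lt_trans (potential_abs_le z) h.
Qed.

Lemma Rintegral_potential_le z : (positive_potential alpha F z < +oo)%E ->
  (`|\int[weighted_area alpha]_w (k (z, w) * r w)|%:E <=
   positive_potential alpha F z)%E.
Proof.
move=> h; have ir := integrable_potential h.
rewrite /Rintegral -fine_abse; last exact: integrable_fin_num.
rewrite fineK; last by rewrite abse_fin_num; exact: integrable_fin_num.
apply: le_trans (potential_abs_le z); exact: le_abse_integral.
Qed.

(** Tonelli's theorem gives the measurability of the integrals of the positive
    and negative parts; the real-valued integral is the finite part of their
    difference, hence measurable even where they are infinite. *)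
Lemma measurable_Rintegral_potential :
  measurable_fun setT (fun z => \int[weighted_area alpha]_w (k (z, w) * r w)).
Proof.
pose kr (zw : (R * R) * (R * R)) : \bar R := (k zw * r zw.2)%:E.
rewrite (_ : (fun z => _) = fine \o (fun z =>
    fubini_F (weighted_area alpha) kr^\+ z -
    fubini_F (weighted_area alpha) kr^\- z)%E); last first.
  apply/funext => z; rewrite /Rintegral /= integralE; congr (fine (_ - _)).
    by apply: eq_integral => w _; rewrite !funeposE.
  by apply: eq_integral => w _; rewrite !funenegE.
apply: measurableT_comp => //; apply: emeasurable_funB.
- apply: measurable_fun_fubini_tonelli_F; first exact: measurable_funepos.
  by move=> zw; exact: funepos_ge0.
- apply: measurable_fun_fubini_tonelli_F; first exact: measurable_funeneg.
  by move=> zw; exact: funeneg_ge0.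
Qed.

End signed.

Lemma Re_positive_bergman_integrand alpha (f : R * R -> R[i]) z w : H z -> H w ->
  complex.Re (positive_bergman_integrand alpha f z w) =
  abs_kernel (2 + alpha) (z, w) * complex.Re (f w).
Proof.
move=> Hz Hw; rewrite abs_kernelE// powRN /positive_bergman_integrand.
by rewrite -fmorphV; case: (f w) => a b /=; rewrite mulr0 subr0 mulrC.
Qed.

Lemma Im_positive_bergman_integrand alpha (f : R * R -> R[i]) z w : H z -> H w ->
  complex.Im (positive_bergman_integrand alpha f z w) =
  abs_kernel (2 + alpha) (z, w) * complex.Im (f w).
Proof.
move=> Hz Hw; rewrite abs_kernelE// powRN /positive_bergman_integrand.
by rewrite -fmorphV; case: (f w) => a b /=; rewrite mulr0 add0r mulrC.
Qed.

Lemma patch_abs_kernel alpha (u v : R * R -> R) z : H z ->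
  (forall w, H w -> u w = abs_kernel (2 + alpha) (z, w) * v w) ->
  u \_ H = (fun w => abs_kernel (2 + alpha) (z, w) * (v \_ H) w).
Proof.
move=> Hz uv; apply/funext => w; rewrite !patchE.
by case: ifPn => [/set_mem Hw|_]; rewrite ?mulr0// uv.
Qed.

Lemma Lnorm_patch mu p (g : R * R -> R) :
  ('N[mu]_p[(fun x => (g x)%:E) \_ H] = 'N[mu]_p[EFin \o (g \_ H)])%E.
Proof. by rewrite restrict_EFin. Qed.

End complex_wrap.

Theorem corollary1p2 (R : realType) (p q alpha : R) :
  1 < p -> p <= q -> -1 < alpha ->
  positive_bergman_bounded alpha
    alpha p%:E (alpha + (2 + alpha) * (q / p - 1)) q%:E.
Proof.
move=> p1 pq a1.
have q0 : 0 < q by lra.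
have [C C0 main] := positive_potential_Lp_Lq a1 p1 pq.
(* The factor 2 comes from |z| <= |Re z| + |Im z|. *)
exists (2 * C) => f [[mRe mIm] fLp].
set H := upper_half_plane R in mRe mIm fLp *.
have mH : measurable H by exact: measurable_upper_half_plane.
set beta := alpha + _ in main *.
pose F := (fun w => normc (f w)) \_ H.
pose u := (fun w => complex.Re (f w)) \_ H.
pose v := (fun w => complex.Im (f w)) \_ H.
have mF : measurable_fun setT F.
  by apply/(measurable_restrictT _ _).1 => //; exact: measurable_normc.
have mu : measurable_fun setT u by apply/(measurable_restrictT _ _).1.
have mv : measurable_fun setT v by apply/(measurable_restrictT _ _).1.
have F0 w : 0 <= F w by rewrite /F patchE; case: ifPn => // _; exact: normc_ge0.
have uF w : `|u w| <= F w.
  by rewrite /u /F !patchE; case: ifPn => _; rewrite ?normr0// normc_ge_Re_abs.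
have vF w : `|v w| <= F w.
  by rewrite /v /F !patchE; case: ifPn => _; rewrite ?normr0// normc_ge_Im_abs.
have NF : cLnorm (weighted_area alpha) H p%:E f =
    'N[weighted_area alpha]_p%:E[EFin \o F]%E by exact: Lnorm_patch.
rewrite NF in fLp *.
have [Gfin bound] := main F mF F0 fLp.
set G := positive_potential alpha F in Gfin bound.
have ReE z : H z ->
    (fun w => complex.Re (positive_bergman_integrand alpha f z w)) \_ H =
    (fun w => abs_kernel (2 + alpha) (z, w) * u w).
  move=> Hz; apply: patch_abs_kernel => // w Hw.
  exact: Re_positive_bergman_integrand.
have ImE z : H z ->
    (fun w => complex.Im (positive_bergman_integrand alpha f z w)) \_ H =
    (fun w => abs_kernel (2 + alpha) (z, w) * v w).
  move=> Hz; apply: patch_abs_kernel => // w Hw.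
  exact: Im_positive_bergman_integrand.
have RePf z : H z -> complex.Re (positive_bergman alpha f z) =
    \int[weighted_area alpha]_w (abs_kernel (2 + alpha) (z, w) * u w).
  by move=> Hz; rewrite /= Rintegral_mkcond ReE.
have ImPf z : H z -> complex.Im (positive_bergman alpha f z) =
    \int[weighted_area alpha]_w (abs_kernel (2 + alpha) (z, w) * v w).
  by move=> Hz; rewrite /= Rintegral_mkcond ImE.
have mPf : cmeasurable_fun H (positive_bergman alpha f).
  split.
  - apply: (eq_measurable_fun (fun z =>
      \int[weighted_area alpha]_w (abs_kernel (2 + alpha) (z, w) * u w))).
      by move=> z /set_mem Hz; rewrite RePf.
    by apply: measurable_funTS; apply: measurable_Rintegral_potential.
  - apply: (eq_measurable_fun (fun z =>
      \int[weighted_area alpha]_w (abs_kernel (2 + alpha) (z, w) * v w))).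
      by move=> z /set_mem Hz; rewrite ImPf.
    by apply: measurable_funTS; apply: measurable_Rintegral_potential.
pose P := (fun z => normc (positive_bergman alpha f z)) \_ H.
have mP : measurable_fun setT P.
  by apply/(measurable_restrictT _ _).1 => //; exact: measurable_normc.
have P0 z : 0 <= P z by rewrite /P patchE; case: ifPn => // _; exact: normc_ge0.
have G0 z : (0 <= G z)%E by exact: positive_potential_ge0.
have PG z : ((P z)%:E <= 2%:E * G z)%E.
  rewrite /P patchE; case: ifPn => [/set_mem Hz|_]; last by rewrite mule_ge0.
  apply: (@le_trans _ _ (`|complex.Re (positive_bergman alpha f z)| +
      `|complex.Im (positive_bergman alpha f z)|)%:E).
    by rewrite lee_fin normc_le_ReIm.
  rewrite EFinD RePf// ImPf// mule_natl mule2n.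
  by apply: leeD; apply: Rintegral_potential_le => //; exact: Gfin.
have PE : cLnorm (weighted_area beta) H q%:E (positive_bergman alpha f) =
    'N[weighted_area beta]_q%:E[EFin \o P]%E by exact: Lnorm_patch.
have Pbound : (cLnorm (weighted_area beta) H q%:E (positive_bergman alpha f) <=
    (2 * C)%:E * 'N[weighted_area alpha]_p%:E[EFin \o F])%E.
  rewrite PE.
  have N0 : (0 <= (2 * C)%:E * 'N[weighted_area alpha]_p%:E[EFin \o F])%E.
    by rewrite mule_ge0 ?Lnorm_ge0// lee_fin mulr_ge0.
  have -> : ((2 * C)%:E * 'N[weighted_area alpha]_p%:E[EFin \o F] =
     ((2 `^ q)%:E * (C%:E * 'N[weighted_area alpha]_p%:E[EFin \o F]) `^ q) `^ q^-1)%E.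
    rewrite -poweR_EFin -poweRM ?mule_ge0 ?Lnorm_ge0 ?lee_fin//.
    by rewrite muleA -EFinM -poweRrM divff ?gt_eqF// poweRe1.
  set N := ('N[weighted_area alpha]_p%:E[EFin \o F])%E in bound *.
  rewrite unlock; apply: gt0_ler_poweR.
  - by rewrite invr_ge0 ltW.
  - by rewrite in_itv/= leey andbT integral_ge0// => z _; rewrite poweR_ge0.
  - by rewrite in_itv/= leey andbT mule_ge0// ?poweR_ge0// lee_fin powR_ge0.
  have mG : measurable_fun setT (fun z => G z `^ q)%E.
    apply: (measurableT_comp (measurable_poweR _)).
    exact: measurable_positive_potential.
  apply: (@le_trans _ _ ((2 `^ q)%:E *
      \int[weighted_area beta]_z (G z `^ q))%E); last first.
    by apply: lee_wpmul2l.
  rewrite -ge0_integralZl//; last by move=> z _; exact: poweR_ge0.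
  apply: ge0_le_integral => //.
  - by move=> z _; exact: poweR_ge0.
  - apply: (measurableT_comp (measurable_poweR _)); apply: measurableT_comp => //.
    exact/measurable_EFinP.
  - exact: measurable_funeM.
  - move=> z _; rewrite -poweR_EFin -(poweRM _ _ (G0 z)) ?lee_fin//.
    rewrite gee0_abs; last by rewrite /= lee_fin.
    apply: gt0_ler_poweR; first exact: ltW.
    + by rewrite in_itv/= leey andbT lee_fin.
    + by rewrite in_itv/= leey andbT mule_ge0.
    + exact: PG.
split => //.
- move=> z Hz; split; apply/(integrable_mkcond _ mH); rewrite restrict_EFin.
  + rewrite ReE//; apply: integrable_potential mF mu uF _ _; exact: Gfin.
  + rewrite ImE//; apply: integrable_potential mF mv vF _ _; exact: Gfin.
- split => //; apply: le_lt_trans Pbound _.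
  by rewrite lte_mul_pinfty// lee_fin mulr_ge0.
Qed.
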